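(* Let $m\ge 2$ be an integer, let $\alpha\in[1,2]$, put $\beta_m=\frac{2\alpha m-2\alpha}{\alpha m-2+\alpha}$, and let $\mathbf{q}=(\beta_m,\ldots,\beta_m,\alpha)$ (with $\beta_m$ repeated $m-1$ times), a multiple exponent of the generalized Bohnenblust--Hille inequality for real scalars. Then the optimal constant satisfies $$C_{m,\infty,\mathbf{q}}^{\mathbb{R}}\;\geq\; 2^{\frac{3\alpha m-2m-5\alpha+4}{2\alpha(m-1)}}.$$
   Context: $\ell_\infty^n$ denotes $\mathbb{R}^n$ with the sup norm, $(e_i)$ is the canonical basis, and for an $m$-linear form $T:\ell_\infty^n\times\cdots\times\ell_\infty^n\to\mathbb{R}$ one sets $\|T\|=\sup\{|T(z^{(1)},\ldots,z^{(m)})| : \|z^{(k)}\|_\infty\le 1,\ 1\le k\le m\}$. Generalized Bohnenblust--Hille inequality: if $m\ge 2$ and $\mathbf{q}=(q_1,\ldots,q_m)\in[1,2]^m$ satisfies $\frac1{q_1}+\cdots+\frac1{q_m}=\frac{m+1}{2}$ (such a $\mathbf{q}$ is called a multiple exponent), then there is a constant $C\ge 1$ such that $$\left(\sum_{j_1=1}^{n}\left(\sum_{j_2=1}^{n}\left(\cdots\left(\sum_{j_m=1}^{n}|T(e_{j_1},\ldots,e_{j_m})|^{q_m}\right)^{\frac{q_{m-1}}{q_m}}\cdots\right)^{\frac{q_2}{q_3}}\right)^{\frac{q_1}{q_2}}\right)^{\frac1{q_1}}\le C\,\|T\|$$ for all positive integers $n$ and all $m$-linear forms $T:\ell_\infty^n\times\cdots\times\ell_\infty^n\to\mathbb{R}$.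 The optimal constant $C_{m,\infty,\mathbf{q}}^{\mathbb{R}}$ is the smallest such $C$. *)

(* Defs.v *)
From mathcomp Require Import all_boot all_order all_algebra.
From mathcomp Require Import all_classical all_reals all_analysis.

Set Implicit Arguments.
Unset Strict Implicit.
Unset Printing Implicit Defensive.

Import Order.TTheory GRing.Theory Num.Theory numFieldNormedType.Exports.

Local Open Scope classical_set_scope.
Local Open Scope ring_scope.

Section BohnenblustHille.
Variable R : realType.

Definition multilinear_form (m n : nat) (T : ('I_m -> 'rV[R]_n) -> R) : Prop :=
  forall (z : 'I_m -> 'rV[R]_n) (k : 'I_m) (a : R) (u v : 'rV[R]_n),
    let Tk x := T (@dfwith 'I_m (fun=> 'rV[R]_n) z k x) in
    Tk (a *: u + v) = a * Tk u + Tk v.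

(* The library norm on row vectors is the sup norm, so ['rV[R]_n] is
   l_infty^n. The supremum is finite for every multilinear form. *)
Definition form_norm (m n : nat) (T : ('I_m -> 'rV[R]_n) -> R) : R :=
  sup [set `|T z| | z in [set z | forall k, `|z k| <= 1]].

(* With q = (q_1, ..., q_m), [iterated_sum p q a] is
     (sum_(j_1) (sum_(j_2) (... (sum_(j_m) |a (j_1, ..., j_m)| ^ q_m)
        ^ (q_(m-1) / q_m) ...) ^ (q_1 / q_2)) ^ (p / q_1),
   so that p = 1 gives the left-hand side of the Bohnenblust-Hille inequality;
   the parameter p carries the exponent of the enclosing sum. *)
Fixpoint iterated_sum (n m : nat) (p : R) {struct m} :
    m.-tuple R -> (m.-tuple 'I_n -> R) -> R :=
  match m with
  | 0 => fun _ a => `|a [tuple]| `^ p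
  | m'.+1 => fun q a =>
      (\sum_(j < n) iterated_sum (thead q) (behead_tuple q)
                      (fun s : m'.-tuple 'I_n => a (cons_tuple j s)))
        `^ (p / thead q)
  end.

Definition multiple_exponent (m : nat) (q : m.-tuple R) : Prop :=
  (forall k : 'I_m, 1 <= tnth q k <= 2) /\
  \sum_(k < m) (tnth q k)^-1 = (m%:R + 1) / 2.

Definition BH_bound (m : nat) (q : m.-tuple R) (C : R) : Prop :=
  1 <= C /\
  forall (n : nat) (T : ('I_m -> 'rV[R]_n) -> R),
    (0 < n)%N -> multilinear_form T ->
    iterated_sum 1 q (fun j => T (fun k => delta_mx 0 (tnth j k)))
      <= C * form_norm T.

(* Taken in the extended reals, so that the value would be +oo, rather than
   a junk real number, if no admissible constant existed. *)
Definition BH_constant (m : nat) (q : m.-tuple R) : \bar R :=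
  ereal_inf [set C%:E | C in [set C | BH_bound q C]].

End BohnenblustHille.

(* Main.v *)
(* The form is built recursively, starting from a single coordinate: with
     T_{0,s} (z) = z(s),
     T_{k+1,s} (z, w) = (z(2s) + z(2s+1)) T_{k,2s} (w)
                        + (z(2s) - z(2s+1)) T_{k,2s+1} (w),
   T = T_{m-1,0} is m-linear, and |x + y| + |x - y| <= 2 on [-1, 1]^2 gives
   ||T|| <= 2^(m-1). It has 4^(m-1) nonzero coefficients, all +1 or -1, and when
   the first m-1 indices are fixed either none or exactly two values of the
   last index give a nonzero coefficient. Since the first m-1 exponents all
   equal beta, the mixed sum is (2^(2m-3) 2^(beta/alpha))^(1/beta), and dividing
   by 2^(m-1) gives the bound. *)
Require Import Defs.
From mathcomp Require Import all_boot all_order all_algebra.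
From mathcomp Require Import all_classical all_reals all_analysis.
From mathcomp Require Import ring lra zify.

Import Order.TTheory GRing.Theory Num.Theory.

Local Open Scope ring_scope.

Lemma sum_ord_block (R : nzRingType) (n b w : nat) (G : nat -> R) (V : R) :
  (b + w <= n)%N ->
  (forall j, (b <= j < b + w)%N -> G j = V) ->
  (forall j, ~~ (b <= j < b + w)%N -> G j = 0) ->
  \sum_(j < n) G j = w%:R * V.
Proof.
move=> bwn G1 G0; rewrite -(big_mkord xpredT G).
rewrite (@big_cat_nat _ _ _ b)//=; last by lia.
rewrite (@big_cat_nat _ _ _ (b + w)%N b)//=; last by lia.
rewrite big_nat big1 ?add0r; last by move=> j hj; apply: G0; lia.
rewrite [X in _ + X]big_nat [X in _ + X]big1 ?addr0; last first.
  by move=> j hj; apply: G0; lia.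
rewrite big_nat (eq_bigr (fun=> V)) => [|j hj]; last exact: G1.
by rewrite -big_nat sumr_const_nat addKn mulr_natl.
Qed.

Lemma ltn_gt_eqF (a b : nat) : (a < b)%N || (b < a)%N -> (a == b) = false.
Proof. by lia. Qed.

(** * The recursive form and its coefficients *)

Section ExtremalForm.
Variable R : realType.
Implicit Types (Z : nat -> nat -> R) (k s n : nat).

(** [Z i p] is coordinate [p] of variable [i]; total functions let the recursion drop the first
    variable by a shift. *)
Fixpoint bh_form k Z s : R :=
  if k is k'.+1 then
    (Z 0%N s.*2 + Z 0%N s.*2.+1) * bh_form k' (fun i => Z i.+1) s.*2
    + (Z 0%N s.*2 - Z 0%N s.*2.+1) * bh_form k' (fun i => Z i.+1) s.*2.+1
  else Z 0%N s.

(** Row 0 enters only the two outer factors and later rows only the recursive calls; rows beyond [k]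
    are never read, hence [r <= k]. *)
Lemma bh_form_linear k (r : nat) (a : R) (x y : nat -> R) Z s :
  (r <= k)%N ->
  bh_form k (fun i p => if i == r then a * x p + y p else Z i p) s =
  a * bh_form k (fun i p => if i == r then x p else Z i p) s
  + bh_form k (fun i p => if i == r then y p else Z i p) s.
Proof.
elim: k r Z s => [|k IH] [|r] Z s //= rk; first by ring.
rewrite !(IH _ (fun i => Z i.+1))//.
ring.
Qed.

Lemma bh_form_le k Z s :
  (forall i p, `|Z i p| <= 1) -> `|bh_form k Z s| <= 2 ^+ k.
Proof.
elim: k Z s => [|k IH] Z s Z1 /=; first by rewrite expr0.
have sumdiff (x y : R) : `|x| <= 1 -> `|y| <= 1 -> `|x + y| + `|x - y| <= 2.
  rewrite !ler_norml => /andP[? ?] /andP[? ?].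
  by case: (ler0P (x + y)) => ?; case: (ler0P (x - y)) => ?; lra.
apply: le_trans (ler_normD _ _) _; rewrite !normrM exprS.
apply: (@le_trans _ _
  ((`|Z 0%N s.*2 + Z 0%N s.*2.+1| + `|Z 0%N s.*2 - Z 0%N s.*2.+1|) * 2 ^+ k)).
  by rewrite mulrDl lerD// ler_wpM2l// IH.
by rewrite ler_wpM2r ?exprn_ge0// sumdiff.
Qed.

(** Row [i] is the basis vector with index [l_i]; rows past the end of [l] are zero. *)
Definition bh_coef k (l : seq nat) s : R :=
  bh_form k (fun i p => (onth l i == Some p)%:R) s.

Lemma bh_coef_cons k j l s :
  bh_coef k.+1 (j :: l) s =
  ((j == s.*2)%:R + (j == s.*2.+1)%:R) * bh_coef k l s.*2
  + ((j == s.*2)%:R - (j == s.*2.+1)%:R) * bh_coef k l s.*2.+1.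
Proof. by []. Qed.

(** * Mixed sums of the coefficients *)

Lemma iterated_sum0 n m (p : R) (q : m.-tuple R) :
  p != 0 -> (forall i, tnth q i != 0) ->
  iterated_sum p q (fun _ : m.-tuple 'I_n => 0) = 0.
Proof.
elim: m p q => [|m IH] p q p0 q0 /=; first by rewrite normr0 powR0.
rewrite big1 => [|j _].
  (* Nonzero exponents matter here: [powR 0 0] is 1. *)
  by rewrite powR0 ?mulf_neq0 ?invr_eq0 /thead.
by apply: IH => [|i]; [exact: q0 | rewrite (tnth_behead q i)].
Qed.

Definition bh_exponent (alpha beta : R) k : k.+1.-tuple R :=
  [tuple if (i < k)%N then beta else alpha | i < k.+1].

Lemma bh_exponent_neq0 (alpha beta : R) k i :
  alpha != 0 -> beta != 0 -> tnth (bh_exponent alpha beta k) i != 0.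
Proof. by rewrite tnth_mktuple; case: ifP. Qed.

Lemma thead_bh_exponent (alpha beta : R) k :
  thead (bh_exponent alpha beta k) = if k is 0 then alpha else beta.
Proof. by rewrite /thead tnth_mktuple; case: k. Qed.

Lemma behead_bh_exponent (alpha beta : R) k :
  behead_tuple (bh_exponent alpha beta k.+1) = bh_exponent alpha beta k.
Proof.
apply: eq_from_tnth => i.
rewrite (tnth_behead (bh_exponent alpha beta k.+1) i) !tnth_mktuple.
by rewrite inordK// ltnS ltn_ord.
Qed.

(* Fixing the first index of T_{k+1} produces one of the combinations
   [e1 T_{k,2s} + e2 T_{k,2s+1}] with signs [e1, e2], and this class is stable
   under fixing further indices; four values of the first index contribute
   until only the last variable is left, for which there are two. *)
Lemma iterated_sum_bh_coef n k s (p e1 e2 alpha beta : R) :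
  (s.+1 * 2 ^ k.+1 <= n)%N -> `|e1| = 1 -> `|e2| = 1 ->
  p != 0 -> alpha != 0 -> beta != 0 ->
  iterated_sum p (bh_exponent alpha beta k)
    (fun l : k.+1.-tuple 'I_n => e1 * bh_coef k (map val l) s.*2
                               + e2 * bh_coef k (map val l) s.*2.+1)
  = (4 ^+ k * 2 `^ (beta / alpha)) `^ (p / beta).
Proof.
elim: k s p e1 e2 => [|k IH] s p e1 e2 sn he1 he2 p0 a0 b0.
  rewrite /= thead_bh_exponent.
  pose G j : R := `|e1 * (j == s.*2)%:R + e2 * (j == s.*2.+1)%:R| `^ alpha.
  rewrite (eq_bigr (fun j : 'I_n => G j)); last first.
    by move=> j _; rewrite /G /bh_coef /= !(inj_eq Some_inj).
  rewrite (@sum_ord_block _ _ s.*2 2 G 1); last 3 first.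
  - by lia.
  - move=> j hj; rewrite /G.
    have [->|->] : j = s.*2 \/ j = s.*2.+1 by lia.
      rewrite eqxx ltn_gt_eqF; last by lia.
      by rewrite mulr1 mulr0 addr0 he1 powR1.
    rewrite eqxx ltn_gt_eqF; last by lia.
    by rewrite mulr1 mulr0 add0r he2 powR1.
  - move=> j hj; rewrite /G !ltn_gt_eqF; [|lia..].
    by rewrite !mulr0 addr0 normr0 powR0.
  rewrite expr0 mul1r mulr1 -powRrM; congr (_ `^ _); field.
  by rewrite a0 b0.
rewrite /= thead_bh_exponent behead_bh_exponent.
pose G j : R := iterated_sum beta (bh_exponent alpha beta k)
  (fun l : k.+1.-tuple 'I_n => e1 * bh_coef k.+1 (j :: map val l) s.*2
                             + e2 * bh_coef k.+1 (j :: map val l) s.*2.+1).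
rewrite (eq_bigr (fun j : 'I_n => G j))//.
(* The inner sum is raised to [beta / beta = 1], so each contributing index adds the same value. *)
have GE t j f1 f2 : (t.+1 * 2 ^ k.+1 <= n)%N -> `|f1| = 1 -> `|f2| = 1 ->
    (forall l, e1 * bh_coef k.+1 (j :: l) s.*2 + e2 * bh_coef k.+1 (j :: l) s.*2.+1
       = f1 * bh_coef k l t.*2 + f2 * bh_coef k l t.*2.+1) ->
    G j = 4 ^+ k * 2 `^ (beta / alpha).
  move=> tn hf1 hf2 E; rewrite /G.
  under eq_fun do rewrite E.
  by rewrite IH// divff// powRr1// mulr_ge0 ?exprn_ge0 ?powR_ge0.
have s4 : (s.*2.*2 + 4 <= n)%N.
  by move: sn; rewrite !expnS; have := expn_gt0 2 k; nia.
have nN (x : R) : `|x| = 1 -> `|- x| = 1 by rewrite normrN.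
rewrite (@sum_ord_block _ _ s.*2.*2 4 G (4 ^+ k * 2 `^ (beta / alpha))) //.
- by rewrite exprS mulrA.
- move=> j hj.
  have s1n : (s.*2.+1 * 2 ^ k.+1 <= n)%N by move: sn; rewrite !expnS; nia.
  have s2n : (s.*2.+2 * 2 ^ k.+1 <= n)%N by move: sn; rewrite !expnS; nia.
  (* Indices 4s and 4s+1 kill the [e2] term and leave e1 (T_{k,4s} ± T_{k,4s+1}); 4s+2 and 4s+3 do
     the same with the roles of [e1] and [e2] exchanged. *)
  have [->|[->|[->|->]]] : j = s.*2.*2 \/ j = s.*2.*2.+1 \/ j = s.*2.+1.*2 \/
    j = s.*2.+1.*2.+1 by lia.
  + apply: (GE s.*2 _ e1 e1) => // l; rewrite !bh_coef_cons.
    rewrite eqxx !ltn_gt_eqF; [rewrite /=; ring|lia..].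
  + apply: (GE s.*2 _ e1 (- e1)) => //; [exact: nN|move=> l].
    rewrite !bh_coef_cons eqxx !ltn_gt_eqF; [rewrite /=; ring|lia..].
  + apply: (GE s.*2.+1 _ e2 e2) => // l; rewrite !bh_coef_cons.
    rewrite eqxx !ltn_gt_eqF; [rewrite /=; ring|lia..].
  + apply: (GE s.*2.+1 _ e2 (- e2)) => //; [exact: nN|move=> l].
    rewrite !bh_coef_cons eqxx !ltn_gt_eqF; [rewrite /=; ring|lia..].
- move=> j hj; rewrite /G.
  under eq_fun.
    move=> l; rewrite !bh_coef_cons !ltn_gt_eqF; [|lia..].
    rewrite !(addr0, subr0, mul0r, mulr0); over.
  by rewrite iterated_sum0// => i; apply: bh_exponent_neq0.
Qed.

(** At the root a single form is expanded rather than a pair, so two first indices contribute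
    instead of four: hence the factor 2. *)
Lemma iterated_sum_bh_coef0 n k (alpha beta : R) :
  (2 ^ k.+1 <= n)%N -> alpha != 0 -> beta != 0 ->
  iterated_sum 1 (bh_exponent alpha beta k.+1)
    (fun l : k.+2.-tuple 'I_n => bh_coef k.+1 (map val l) 0)
  = (2 * (4 ^+ k * 2 `^ (beta / alpha))) `^ (1 / beta).
Proof.
move=> kn a0 b0 /=.
rewrite thead_bh_exponent behead_bh_exponent.
pose G j : R := iterated_sum beta (bh_exponent alpha beta k)
  (fun l : k.+1.-tuple 'I_n => bh_coef k.+1 (j :: map val l) 0).
rewrite (eq_bigr (fun j : 'I_n => G j))//.
have GE j f2 : `|f2| = 1 ->
    (forall l, bh_coef k.+1 (j :: l) 0
       = 1 * bh_coef k l 0.*2 + f2 * bh_coef k l 0.*2.+1) ->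
    G j = 4 ^+ k * 2 `^ (beta / alpha).
  move=> hf2 E; rewrite /G.
  under eq_fun do rewrite E.
  by rewrite iterated_sum_bh_coef ?mul1n ?normr1// divff// powRr1//.
rewrite (@sum_ord_block _ _ 0 2 G (4 ^+ k * 2 `^ (beta / alpha))) //.
- by apply: leq_trans kn; rewrite expnS; have := expn_gt0 2 k; lia.
- move=> [|[|//]] _.
  + by apply: (GE _ 1); rewrite ?normr1// => l; rewrite bh_coef_cons /=; ring.
  + apply: (GE _ (-1)); rewrite ?normrN ?normr1// => l.
    by rewrite bh_coef_cons /=; ring.
- move=> [|[|j]]// _; rewrite /G.
  under eq_fun do rewrite bh_coef_cons /= !(addr0, subr0, mul0r).
  by rewrite iterated_sum0// => i; apply: bh_exponent_neq0.
Qed.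

(** * The form on row vectors *)

Definition coords {m n} (z : 'I_m -> 'rV[R]_n) (i p : nat) : R :=
  oapp (fun i' : 'I_m => oapp (fun p' : 'I_n => z i' 0 p') 0 (insub p)) 0 (insub i).

Definition bh_form_rV {k n} (z : 'I_k.+1 -> 'rV[R]_n) : R :=
  bh_form k (coords z) 0.

Lemma bh_form_rV_multilinear k n : multilinear_form (@bh_form_rV k n).
Proof.
move=> z r a u v /=; rewrite /bh_form_rV.
pose row (x : 'rV[R]_n) p : R := oapp (fun p' : 'I_n => x 0 p') 0 (insub p).
(* Replacing the [r]-th vector overwrites row [r], the shape [bh_form_linear] expects. *)
have cE x : coords (dfwith z r x) =
    fun i p => if i == r :> nat then row x p else coords z i p.
  apply/funext => i; apply/funext => p; rewrite /coords.
  case: (insubP 'I_k.+1 i) => [i' _ <-|] /=.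
    rewrite (inj_eq val_inj); case: eqVneq => [->|i'r]; first by rewrite dfwithin.
    by rewrite dfwithout// eq_sym.
  by case: eqVneq => // ->; rewrite ltn_ord.
rewrite !cE -bh_form_linear; last by rewrite -ltnS.
congr bh_form; apply/funext => i; apply/funext => p; case: eqP => // _.
by rewrite /row; case: (insubP 'I_n p) => [p' _ _|_] /=; rewrite ?mxE//; ring.
Qed.

Lemma bh_form_rV_delta k n (l : k.+1.-tuple 'I_n) :
  bh_form_rV (fun i => delta_mx 0 (tnth l i)) = bh_coef k (map val l) 0.
Proof.
congr bh_form; apply/funext => i; apply/funext => p; rewrite /coords onthE.
case: (insubP 'I_k.+1 i) => [i' _ <-|] /=; last first.
  by rewrite -leqNgt => ki; rewrite nth_default// !size_map size_tuple.
rewrite -map_comp (nth_map (tnth l i')) ?size_tuple// -tnth_nth /=.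
rewrite (inj_eq Some_inj).
case: (insubP 'I_n p) => [p' _ <-|] /=; first by rewrite mxE eqxx/= eq_sym.
by case: eqP => // <-; rewrite ltn_ord.
Qed.

Lemma ler_entry_norm n (x : 'rV[R]_n) p : `|x 0 p| <= `|x|.
Proof.
rewrite [leRHS]/Num.norm /= mx_normrE; apply/bigmax_geP; right => /=.
by exists (0, p).
Qed.

Lemma bh_form_rV_norm k n : form_norm (@bh_form_rV k n) <= 2 ^+ k.
Proof.
apply: ge_sup.
  by exists `|@bh_form_rV k n (fun=> 0)|, (fun=> 0) => // i; rewrite normr0.
move=> _ [z /= z1 <-]; apply: bh_form_le => i p; rewrite /coords.
(* Entries outside the index ranges are padded with 0, so the bound 1 covers them. *)
case: (insubP 'I_k.+1 i) => [i' _ _|_] /=; last by rewrite normr0.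
case: (insubP 'I_n p) => [p' _ _|_] /=; last by rewrite normr0.
exact: le_trans (ler_entry_norm _ _ _) (z1 i').
Qed.

Lemma BH_bound_ge k (alpha beta C : R) : alpha != 0 -> beta != 0 ->
  BH_bound (bh_exponent alpha beta k.+1) C ->
  (2 * (4 ^+ k * 2 `^ (beta / alpha))) `^ (1 / beta) <= C * 2 ^+ k.+1.
Proof.
(* Indices double with each further variable, so dimension 2^(k+1) holds all of them. *)
move=> a0 b0 [C1 /(_ (2 ^ k.+1)%N _ _ (bh_form_rV_multilinear _ _))].
rewrite expn_gt0 => /(_ isT).
under eq_fun do rewrite bh_form_rV_delta.
rewrite iterated_sum_bh_coef0// => /le_trans; apply.
by rewrite ler_wpM2l ?bh_form_rV_norm// (le_trans ler01).
Qed.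

End ExtremalForm.

Theorem proposition5p1 (R : realType) (m : nat) (alpha : R) :
  (2 <= m)%N -> 1 <= alpha <= 2 ->
  let beta : R :=
    (2 * alpha * m%:R - 2 * alpha) / (alpha * m%:R - 2 + alpha) in
  let q : m.-tuple R :=
    [tuple if (i < m.-1)%N then beta else alpha | i < m] in
  multiple_exponent q /\
  ((2 `^ ((3 * alpha * m%:R - 2 * m%:R - 5 * alpha + 4)
            / (2 * alpha * (m%:R - 1))))%:E <= BH_constant q)%E.
Proof.
case: m => [|[|k]]// _ /andP[a1 a2] beta q.
have k0 : 0 <= k%:R :> R by [].
have mE : k.+2%:R = k%:R + 2 :> R by rewrite -addn2 natrD.
(* Gives alpha k >= k >= 0, the nonlinear input for the sign conditions and for [1 <= beta]. *)
have ak : 0 <= (alpha - 1) * k%:R by rewrite mulr_ge0// subr_ge0.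
have a0 : alpha != 0 by lra.
have D0 : 0 < alpha * k.+2%:R - 2 + alpha by rewrite mE; nra.
have N0 : 0 < 2 * alpha * k.+2%:R - 2 * alpha by rewrite mE; nra.
have b0 : beta != 0 by rewrite mulf_neq0 ?invr_eq0 ?gt_eqF.
have D0' : (alpha * (k%:R + 2) - 2 + alpha) != 0 by rewrite -mE gt_eqF.
split.
  split=> [i|].
    rewrite tnth_mktuple; case: ifP => _; last by rewrite a1.
    by rewrite ler_pdivlMr// ler_pdivrMr// mE; apply/andP; split; nra.
  rewrite big_ord_recr /= tnth_mktuple /= ltnn.
  rewrite (eq_bigr (fun=> beta^-1)); last first.
    by move=> i _; rewrite tnth_mktuple /= ltn_ord.
  rewrite sumr_const card_ord -[_ *+ k.+1]mulr_natr /beta invf_div mE.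
  rewrite (_ : k.+1%:R = k%:R + 1 :> R); last by rewrite -addn1 natrD.
  field.
  by rewrite a0; lra.
apply: le_ereal_inf_tmp => _ [C /(BH_bound_ge _ _ _ _ _ a0 b0) CB <-].
rewrite lee_fin -(ler_pM2r (_ : 0 < 2 ^+ k.+1)) ?exprn_gt0//.
(* Equality holds: both sides are the power of 2 with exponent (2m-3)/beta + 1/alpha. *)
apply: le_trans CB; rewrite le_eqVlt; apply/orP; left; apply/eqP.
have p2 (x y : R) : 2 `^ x * 2 `^ y = 2 `^ (x + y).
  by rewrite powRD// pnatr_eq0 implybT.
have -> : 4 ^+ k = 2 `^ (2 * k%:R) :> R.
  by rewrite powRrM !powR_mulrn ?powR_ge0// expr2 -natrM.
have p21 (x : R) : 2 * 2 `^ x = 2 `^ (1 + x) by rewrite -p2 powRr1.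
rewrite -powR_mulrn// !p2 p21 -powRrM.
congr (_ `^ _); rewrite /beta.
rewrite mE (_ : k.+1%:R = k%:R + 1 :> R); last by rewrite -addn1 natrD.
field.
by rewrite D0' -mE (gt_eqF N0) a0 mE; lra.
Qed.
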